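(* Let $k$ be an algebraically closed field of characteristic zero and let $G_1,G_2$ be finite groups. Then $G_1$ and $G_2$ have the same character tables if and only if their group algebras are isomorphic as quasi-Hopf algebras, i.e. if and only if there exist an isomorphism of $k$-algebras $f:k[G_1]\to k[G_2]$ and an invertible element $F\in k[G_2]\otimes k[G_2]$ such that $$F\,\Delta_2(f(x)) = (f\otimes f)(\Delta_1(x))\,F\qquad\text{for all } x\in k[G_1].$$
   Context: For a finite group $G_i$, the group algebra $k[G_i]$ carries the coproduct $\Delta_i:k[G_i]\to k[G_i]\otimes k[G_i]$, the linear map with $\Delta_i(g)=g\otimes g$ for $g\in G_i$. $\mathrm{Irr}(G)$ is the set of irreducible ($k$-valued) characters of $G$ (for $k=\mathbb{C}$, the complex irreducible characters) and $cl(G)$ the set of conjugacy classes of $G$. Two finite groups $G_1,G_2$ have the same character tables if there are bijections $\mathrm{Irr}(G_1)\to\mathrm{Irr}(G_2)$, $\chi\mapsto\chi^*$, and $cl(G_1)\to cl(G_2)$, $C\mapsto C^*$, such that $\chi^*(C^* )=\chi(C)$ for all $\chi\in\mathrm{Irr}(G_1)$ and $C\in cl(G_1)$. The isomorphism is not required to satisfy any compatibility with associators. *)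

(* Defs.v *)
From HB Require Import structures.
From mathcomp Require Import all_boot all_order all_algebra all_fingroup.
From mathcomp Require Import all_solvable all_field all_character.
From mathcomp Require Import boolp classical_sets functions.

Set Implicit Arguments.
Unset Strict Implicit.
Unset Printing Implicit Defensive.

Import GroupScope GRing.Theory.
Local Open Scope ring_scope.

(* MathComp's [irr G] consists of algC-valued characters, so Irr(G) over an   *)
(* arbitrary field k is built here from matrix representations over k.        *)
Definition Irr (k : fieldType) (G : finGroupType) : set {ffun G -> k} :=
  fun chi => exists (n : nat) (rG : mx_representation k [set: G]%G n),
    mx_irreducible rG /\ forall g : G, chi g = \tr (rG g).
Arguments Irr : clear implicits.

Definition cl (G : finGroupType) : set {set G} :=
  fun C => C \in classes [set: G].
Arguments cl : clear implicits.

(* The bijections chi |-> chi^* and C |-> C^* are total functions, only       *)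
(* constrained on Irr G1 and cl G1. The value of a character at a class C is  *)
(* its value at any element of C.                                             *)
Definition same_character_tables (k : fieldType) (G1 G2 : finGroupType) : Prop :=
  exists (s : {ffun G1 -> k} -> {ffun G2 -> k}) (t : {set G1} -> {set G2}),
    [/\ set_bij (Irr k G1) (Irr k G2) s,
        set_bij (cl G1) (cl G2) t
      & forall chi C, Irr k G1 chi -> cl G1 C ->
          forall g h, g \in C -> h \in t C -> s chi h = chi g].

(* The group algebra k[G]: an element is identified with the family of its    *)
(* coefficients. This is an alias because {ffun G -> k} itself carries the    *)
(* pointwise product.                                                         *)
Definition galg (k : fieldType) (G : finGroupType) : Type := {ffun G -> k^o}.

Section GroupAlgebra.
Variables (k : fieldType) (G : finGroupType).

HB.instance Definition _ := Vector.copy (galg k G) {ffun G -> k^o}.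

Definition gcoef (x : galg k G) (g : G) : k := (x : {ffun G -> k^o}) g.

Definition galg_of (F : G -> k) : galg k G := ([ffun g => F g] : {ffun G -> k^o}).

Definition galg_one : galg k G := galg_of (fun g => (g == 1%g)%:R).

Definition galg_mul (x y : galg k G) : galg k G :=
  galg_of (fun g => \sum_(h : G) gcoef x h * gcoef y (h^-1 * g)%g).

Definition gelt (g : G) : galg k G := galg_of (fun h => (h == g)%:R).

Lemma galg_ofE F g : gcoef (galg_of F) g = F g.
Proof. exact: ffunE. Qed.

Lemma galgP (x y : galg k G) : (forall g, gcoef x g = gcoef y g) <-> x = y.
Proof. by split=> [xy | -> //]; apply/ffunP. Qed.

Lemma galgDE (x y : galg k G) g : gcoef (x + y) g = gcoef x g + gcoef y g.
Proof. exact: ffunE. Qed.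

Lemma galgZE a (x : galg k G) g : gcoef (a *: x) g = a * gcoef x g.
Proof. exact: ffunE. Qed.

Lemma galg_0E g : gcoef (0 : galg k G) g = 0.
Proof. exact: ffunE. Qed.

Lemma galg_sumE (I : Type) (r : seq I) (P : pred I) (F : I -> galg k G) g :
  gcoef (\sum_(i <- r | P i) F i) g = \sum_(i <- r | P i) gcoef (F i) g.
Proof.
exact: (big_morph (gcoef^~ g) (fun x y => galgDE x y g) (galg_0E g)).
Qed.

Fact galg_mulA : associative galg_mul.
Proof.
move=> x y z; apply/galgP => g; rewrite !galg_ofE.
under eq_bigr do rewrite galg_ofE big_distrr /=.
under [RHS]eq_bigr do rewrite galg_ofE big_distrl /=.
rewrite [RHS]exchange_big /=; apply: eq_bigr => h _.
rewrite [RHS](reindex_inj (mulgI h)) /=; apply: eq_bigr => u _.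
by rewrite mulrA mulKg invMg mulgA.
Qed.

Fact galg_mul1x : left_id galg_one galg_mul.
Proof.
move=> x; apply/galgP => g; rewrite galg_ofE (bigD1 1%g) //= big1 => [|h h1].
  by rewrite galg_ofE eqxx mul1r addr0 invg1 mul1g.
by rewrite galg_ofE (negbTE h1) mul0r.
Qed.

Fact galg_mulx1 : right_id galg_one galg_mul.
Proof.
move=> x; apply/galgP => g; rewrite galg_ofE (bigD1 g) //= big1 => [|h hg].
  by rewrite galg_ofE mulVg eqxx mulr1 addr0.
by rewrite galg_ofE -eq_mulVg1 (negbTE hg) mulr0.
Qed.

Fact galg_mulDl : left_distributive galg_mul +%R.
Proof.
move=> x y z; apply/galgP => g; rewrite galgDE !galg_ofE -big_split /=.
by apply: eq_bigr => h _; rewrite galgDE mulrDl.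
Qed.

Fact galg_mulDr : right_distributive galg_mul +%R.
Proof.
move=> x y z; apply/galgP => g; rewrite galgDE !galg_ofE -big_split /=.
by apply: eq_bigr => h _; rewrite galgDE mulrDr.
Qed.

Fact galg_one_neq0 : galg_one != 0.
Proof.
apply/eqP => /galgP/(_ 1%g); rewrite galg_ofE eqxx galg_0E => /eqP.
by rewrite oner_eq0.
Qed.

HB.instance Definition _ := GRing.Zmodule_isNzRing.Build (galg k G)
  galg_mulA galg_mul1x galg_mulx1 galg_mulDl galg_mulDr galg_one_neq0.

Fact galg_scaleAl (a : k) (x y : galg k G) : a *: (x * y) = (a *: x) * y.
Proof.
apply/galgP => g; rewrite galgZE !galg_ofE big_distrr /=.
by apply: eq_bigr => h _; rewrite galgZE mulrA.
Qed.

HB.instance Definition _ :=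
  GRing.Lmodule_isLalgebra.Build k (galg k G) galg_scaleAl.

Fact galg_scaleAr (a : k) (x y : galg k G) : a *: (x * y) = x * (a *: y).
Proof.
apply/galgP => g; rewrite galgZE !galg_ofE big_distrr /=.
by apply: eq_bigr => h _; rewrite galgZE mulrCA.
Qed.

HB.instance Definition _ :=
  GRing.Lalgebra_isAlgebra.Build k (galg k G) galg_scaleAr.

HB.instance Definition _ := Algebra_isFalgebra.Build k (galg k G).

Lemma geltE g h : gcoef (gelt g) h = (h == g)%:R.
Proof. exact: galg_ofE. Qed.

Lemma galg_mulE (x y : galg k G) g : gcoef (x * y) g = \sum_h gcoef x h * gcoef y (h^-1 * g)%g.
Proof. exact: galg_ofE. Qed.

Lemma gelt1 : gelt 1%g = 1.
Proof. by []. Qed.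

Lemma geltM g h : gelt (g * h)%g = gelt g * gelt h.
Proof.
apply/galgP => u; rewrite galg_mulE geltE (bigD1 g) //= big1 => [|v vg].
  by rewrite !geltE eqxx mul1r addr0 (can2_eq (mulKVg g) (mulKg g)).
by rewrite geltE (negbTE vg) mul0r.
Qed.

Lemma galg_decomp (x : galg k G) : x = \sum_g gcoef x g *: gelt g.
Proof.
apply/galgP => h; rewrite galg_sumE (bigD1 h) //= big1 => [|g gh].
  by rewrite galgZE geltE eqxx mulr1 addr0.
by rewrite galgZE geltE eq_sym (negbTE gh) mulr0.
Qed.

End GroupAlgebra.

(* The tensor product k[G] (x) k[H] is realized as k[G * H], with             *)
(* coefficients (x (x) y)(g, h) = x(g) y(h). [tensM], [tens1] and             *)
(* [tens_universal] show that this is the tensor product of algebras.         *)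
Definition tens (k : fieldType) (G H : finGroupType)
    (x : galg k G) (y : galg k H) : galg k (G * H)%type :=
  galg_of (fun p => gcoef x p.1 * gcoef y p.2).

Definition tens_map (k : fieldType) (G1 H1 G2 H2 : finGroupType)
    (f : {linear galg k G1 -> galg k G2}) (f' : {linear galg k H1 -> galg k H2})
    (x : galg k (G1 * H1)%type) : galg k (G2 * H2)%type :=
  \sum_p gcoef x p *: tens (f (gelt k p.1)) (f' (gelt k p.2)).

Definition comul (k : fieldType) (G : finGroupType) (x : galg k G) :
    galg k (G * G)%type :=
  \sum_g gcoef x g *: tens (gelt k g) (gelt k g).

Section TensorTheory.
Variable k : fieldType.

Lemma tensE (G H : finGroupType) (x : galg k G) (y : galg k H) p :
  gcoef (tens x y) p = gcoef x p.1 * gcoef y p.2.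
Proof. exact: galg_ofE. Qed.

Lemma tens_gelt (G H : finGroupType) (g : G) (h : H) :
  tens (gelt k g) (gelt k h) = gelt k (g, h).
Proof. by apply/galgP => -[u v]; rewrite tensE !geltE /= -natrM mulnb. Qed.

Lemma tensM (G H : finGroupType) (x x' : galg k G) (y y' : galg k H) :
  tens x y * tens x' y' = tens (x * x') (y * y').
Proof.
apply/galgP => -[u v]; rewrite tensE !galg_mulE big_distrlr /=.
rewrite pair_big /=; apply: eq_bigr => -[g h] _.
by rewrite !tensE /= mulrACA.
Qed.

Lemma tens1 (G H : finGroupType) : tens (1 : galg k G) (1 : galg k H) = 1.
Proof. by rewrite -!gelt1 tens_gelt. Qed.

Lemma tens_linearl (G H : finGroupType) (y : galg k H) :
  linear (fun x : galg k G => tens x y).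
Proof.
move=> a x x'; apply/galgP => p.
by rewrite galgDE galgZE !tensE galgDE galgZE mulrDl mulrA.
Qed.

Lemma tens_linearr (G H : finGroupType) (x : galg k G) :
  linear (fun y : galg k H => tens x y).
Proof.
move=> a y y'; apply/galgP => p.
by rewrite galgDE galgZE !tensE galgDE galgZE mulrDr mulrCA.
Qed.

Lemma bilinear_decomp (G H : finGroupType) (V : lmodType k)
    (B : galg k G -> galg k H -> V) :
  (forall x, linear (B x)) -> (forall y, linear (B^~ y)) ->
  forall x y, B x y = \sum_p (gcoef x p.1 * gcoef y p.2) *: B (gelt k p.1) (gelt k p.2).
Proof.
move=> Br Bl x y.
pose ml y := GRing.isLinear.Build k (galg k G) V *:%R (B^~ y) (Bl y).
pose mr x := GRing.isLinear.Build k (galg k H) V *:%R (B x) (Br x).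
pose L y : {linear galg k G -> V} := HB.pack (B^~ y) (ml y).
pose R x : {linear galg k H -> V} := HB.pack (B x) (mr x).
rewrite -[LHS]/(L y x) {1}[x]galg_decomp linear_sum /=.
rewrite -(pair_bigA _ (fun g h => (gcoef x g * gcoef y h) *: B (gelt k g) (gelt k h))) /=.
apply: eq_bigr => g _; rewrite -[B _ y]/(L y _) linearZ /=.
rewrite -[B _ y]/(R (gelt k g) y) {1}[y]galg_decomp linear_sum scaler_sumr.
by apply: eq_bigr => h _; rewrite linearZ scalerA.
Qed.

Lemma tens_universal (G H : finGroupType) (V : lmodType k)
    (B : galg k G -> galg k H -> V) :
  (forall x, linear (B x)) -> (forall y, linear (B^~ y)) ->
  exists L : {linear galg k (G * H)%type -> V},
    (forall x y, L (tens x y) = B x y) /\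
    forall L' : {linear galg k (G * H)%type -> V},
      (forall x y, L' (tens x y) = B x y) -> L' =1 L.
Proof.
move=> Br Bl.
pose f (z : galg k (G * H)%type) := \sum_p gcoef z p *: B (gelt k p.1) (gelt k p.2).
have flin : linear f.
  move=> a z z'; rewrite /f scaler_sumr -big_split /=; apply: eq_bigr => p _.
  by rewrite galgDE galgZE scalerDl scalerA.
pose m := GRing.isLinear.Build k (galg k (G * H)%type) V *:%R f flin.
pose L : {linear galg k (G * H)%type -> V} := HB.pack f m.
exists L; split=> [x y | L' L'B z].
  rewrite (bilinear_decomp Br Bl) /= /f.
  by apply: eq_bigr => p _; rewrite tensE.
rewrite {1}[z]galg_decomp linear_sum /= /f; apply: eq_bigr => -[g h] _.
by rewrite linearZ /= -tens_gelt L'B.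
Qed.

Lemma tens_map_tens (G1 H1 G2 H2 : finGroupType)
    (f : {linear galg k G1 -> galg k G2}) (f' : {linear galg k H1 -> galg k H2})
    (x : galg k G1) (y : galg k H1) :
  tens_map f f' (tens x y) = tens (f x) (f' y).
Proof.
have Br u : linear (fun v => tens (f u) (f' v)).
  by move=> a v v'; rewrite linearP tens_linearr.
have Bl v : linear (fun u => tens (f u) (f' v)).
  by move=> a u u'; rewrite linearP tens_linearl.
rewrite (bilinear_decomp Br Bl) /tens_map.
by apply: eq_bigr => p _; rewrite tensE.
Qed.

Lemma comul_gelt (G : finGroupType) (g : G) :
  comul (gelt k g) = tens (gelt k g) (gelt k g).
Proof.
rewrite /comul (bigD1 g) //= big1 => [|h hg].
  by rewrite geltE eqxx scale1r addr0.
by rewrite geltE (negbTE hg) scale0r.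
Qed.

End TensorTheory.

(* Isomorphism of quasi-Hopf algebras k[G1] -> k[G2]: an isomorphism of       *)
(* unital k-algebras together with a twist F; no compatibility with           *)
(* associators is required.                                                   *)
Definition qHopf_isomorphic (k : fieldType) (G1 G2 : finGroupType) : Prop :=
  exists (f : {lrmorphism galg k G1 -> galg k G2})
         (F : galg k (G2 * G2)%type),
    [/\ bijective f, F \is a GRing.unit
      & forall x : galg k G1,
          F * comul (f x) = tens_map f f (comul x) * F].

(* Main.v *)
From HB Require Import structures.
Require Import Defs.
From mathcomp Require Import all_boot all_order all_algebra all_fingroup.
From mathcomp Require Import all_solvable all_field all_character.
From mathcomp Require Import boolp classical_sets functions.

Set Implicit Arguments.
Unset Strict Implicit.
Unset Printing Implicit Defensive.

Import GroupScope GRing.Theory.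
Local Open Scope ring_scope.

Local Notation reprT k G n := (mx_representation k [set: G]%G n).

(** Everything is controlled by one relation on a group algebra: two elements
    [a] and [b] are trace equivalent if every class function, extended
    linearly, takes the same value on [a] and [b].

    From tables to a twist. Because the characters of G2 take positive integer
    values at the class matched with {1}, that class is {1}
    ([natural_character_eq1]), so that matched irreducible characters have
    equal degrees. By Wedderburn's theorem both group algebras are then the
    same product of matrix algebras, and matching the blocks gives an algebra
    isomorphism [f] with s(chi) o f = chi for all irreducible chi. Let [g] in
    G1, and let [h] lie in the class matched with that of [g]. Irreducible
    characters do not distinguish f(g) from [h], and they span the class
    functions ([lin_ext_class_eq0]), so f(g) and [h] are trace equivalent.
    A class function on G2 x G2 is a trace in each tensor factor, and composed
    with the coproduct it is a class function on G2; hence f(g) (x) f(g) and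
    Delta2(f(g)) are both trace equivalent to (h, h). It remains to see that
    two multiplicative maps from a group into the units of a group algebra
    k[H] that agree up to trace equivalence are conjugate by a unit
    ([conjugating_unit]). Each of them, together with right translations,
    makes k[H] a representation of G1 x H; the two representations have equal
    characters, so they are similar in characteristic zero
    ([mx_rsim_mxtrace]), and a similarity commuting with right translations is
    left multiplication by a unit, the twist.

    From a twist to tables. Pulling functions back along [f] carries class
    functions to class functions and irreducible characters to irreducible
    characters. It is multiplicative on class functions: the value of
    phi psi on f(g) is that of phi (x) psi on Delta2(f(g)), and the conjugation
    by the twist is invisible to a class function of G2 x G2
    ([pullback_mul]). An algebra isomorphism between the algebras of functions
    on two finite sets comes from a bijection of these sets, which here are
    the sets of conjugacy classes. *)
(** * Linear extension to the group algebra *)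

Section Evaluation.
Variables (k : fieldType) (G : finGroupType).
Implicit Types (x y : galg k G) (g h : G).

Definition repr_ext n (rG : reprT k G n) x : 'M[k]_n := \sum_g gcoef x g *: rG g.

Lemma repr_ext_linear n (rG : reprT k G n) : linear (repr_ext rG).
Proof.
move=> a x y; rewrite /repr_ext scaler_sumr -big_split /=; apply: eq_bigr => g _.
by rewrite galgDE galgZE scalerDl scalerA.
Qed.
HB.instance Definition _ n (rG : reprT k G n) :=
  GRing.isLinear.Build k (galg k G) 'M[k]_n _ (repr_ext rG) (repr_ext_linear rG).

Lemma repr_ext_gelt n (rG : reprT k G n) g : repr_ext rG (gelt k g) = rG g.
Proof.
rewrite /repr_ext (bigD1 g) //= big1 => [|h hg].
  by rewrite geltE eqxx scale1r addr0.
by rewrite geltE (negbTE hg) scale0r.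
Qed.

Lemma repr_ext1 n (rG : reprT k G n) : repr_ext rG 1 = 1%:M.
Proof. by rewrite -gelt1 repr_ext_gelt repr_mx1. Qed.

Lemma repr_extM n (rG : reprT k G n) x y :
  repr_ext rG (x * y) = repr_ext rG x *m repr_ext rG y.
Proof.
rewrite [x]galg_decomp mulr_suml !(linear_sum (repr_ext rG)) mulmx_suml /=.
apply: eq_bigr => g _; rewrite -scalerAl !linearZ -scalemxAl; congr (_ *: _).
rewrite [y]galg_decomp mulr_sumr !(linear_sum (repr_ext rG)) mulmx_sumr /=.
apply: eq_bigr => h _.
by rewrite -scalerAr !linearZ /= -geltM !repr_ext_gelt repr_mxM ?inE.
Qed.

Lemma repr_ext_rsim n1 (r1 : reprT k G n1) n2 (r2 : reprT k G n2) :
  mx_rsim r1 r2 -> exists (B : 'M_(n1, n2)) (C : 'M_(n2, n1)),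
    [/\ B *m C = 1%:M, C *m B = 1%:M
      & forall x, repr_ext r1 x = B *m repr_ext r2 x *m C].
Proof.
case=> B def_n1; rewrite def_n1 in r1 B * => injB homB.
rewrite row_free_unit in injB; exists B, (invmx B).
rewrite mulmxV // mulVmx //; split=> // x; rewrite /repr_ext mulmx_sumr mulmx_suml.
apply: eq_bigr => g _; rewrite -scalemxAr -scalemxAl -homB ?inE //.
by rewrite mulmxK.
Qed.

Lemma mxtrace_repr_ext_rsim n1 (r1 : reprT k G n1) n2 (r2 : reprT k G n2) x :
  mx_rsim r1 r2 -> \tr (repr_ext r1 x) = \tr (repr_ext r2 x).
Proof.
case/repr_ext_rsim=> B [C [_ CB ->]].
by rewrite mxtrace_mulC mulmxA CB mul1mx.
Qed.

Lemma val_submod_repr_ext n (rG : reprT k G n) (U : 'M_n) (modU : mxmodule rG U)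
    m (W : 'M_(m, \rank U)) x :
  val_submod (W *m repr_ext (submod_repr modU) x) = val_submod W *m repr_ext rG x.
Proof.
rewrite !mulmx_sumr linear_sum; apply: eq_bigr => g _.
by rewrite -!scalemxAr linearZ -(val_submodJ modU) ?inE.
Qed.

Lemma gring_op_repr_ext n (rG : reprT k G n) x :
  gring_op rG (repr_ext (regular_repr k [set: G]%G) x) = repr_ext rG x.
Proof.
rewrite linear_sum; apply: eq_bigr => g _.
by rewrite linearZ /= gring_opG ?inE.
Qed.

Lemma repr_ext_onto n (rG : reprT k G n) A :
  (A \in enveloping_algebra_mx rG)%MS -> exists x, repr_ext rG x = A.
Proof.
case/envelop_mxP=> a ->; exists (galg_of a); apply: eq_big => [g|g _].
  by rewrite inE.
by rewrite galg_ofE.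
Qed.

Definition lin_ext (phi : G -> k) x : k := \sum_g gcoef x g * phi g.

Lemma lin_ext_linear phi : linear_for *%R (lin_ext phi).
Proof.
move=> a x y; rewrite /lin_ext mulr_sumr -big_split /=; apply: eq_bigr => g _.
by rewrite galgDE galgZE mulrDl mulrA.
Qed.
HB.instance Definition _ phi :=
  GRing.isLinear.Build k (galg k G) k _ (lin_ext phi) (lin_ext_linear phi).

Lemma lin_ext_gelt phi g : lin_ext phi (gelt k g) = phi g.
Proof.
rewrite /lin_ext (bigD1 g) //= big1 => [|h hg].
  by rewrite geltE eqxx mul1r addr0.
by rewrite geltE (negbTE hg) mul0r.
Qed.

Lemma eq_lin_ext phi psi : phi =1 psi -> lin_ext phi =1 lin_ext psi.
Proof. by move=> e x; apply: eq_bigr => g _; rewrite e. Qed.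

Lemma lin_ext_trace n (rG : reprT k G n) x :
  lin_ext (fun g => \tr (rG g)) x = \tr (repr_ext rG x).
Proof. by rewrite linear_sum; apply: eq_bigr => g _; rewrite linearZ. Qed.

Definition class_function (phi : G -> k) :=
  forall g h, phi (g * h)%g = phi (h * g)%g.

(** The linear extensions of class functions are exactly the trace functionals
    of the group algebra; [trace_functional_eq] uses the other inclusion. *)
Lemma lin_extC phi : class_function phi ->
  forall x y, lin_ext phi (x * y) = lin_ext phi (y * x).
Proof.
move=> cf x y; rewrite [x]galg_decomp mulr_suml mulr_sumr !linear_sum /=.
apply: eq_bigr => g _; rewrite -scalerAl -scalerAr !linearZ /=; congr (_ * _).
rewrite [y]galg_decomp mulr_suml mulr_sumr !linear_sum /=; apply: eq_bigr => h _.
by rewrite -scalerAl -scalerAr !linearZ /= -!geltM !lin_ext_gelt cf.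
Qed.

(** Equality modulo the span of the commutators [x y - y x]. *)
Definition trace_equiv (a b : galg k G) :=
  forall phi, class_function phi -> lin_ext phi a = lin_ext phi b.
End Evaluation.

(** * Split semisimplicity in characteristic zero *)

(** In a rank factorization [A = C R] of an idempotent, [R C] is the identity
    of size [\rank A]. *)
Lemma idempotent_mxtrace (F : fieldType) n (A : 'M[F]_n) :
  A *m A = A -> \tr A = (\rank A)%:R.
Proof.
move: (mulmx_base A) (col_base_full A) (row_base_free A).
move: (col_base A) (row_base A); move: (\rank A) => r C R <-.
move=> /row_fullP[C' C'C] /row_freeP[R' RR'] AA.
have := congr1 (fun B => C' *m B *m R') AA.
rewrite !mulmxA C'C mul1mx -!mulmxA RR' mulmx1 => RC.
by rewrite mxtrace_mulC RC mxtrace1.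
Qed.

Section SplitSemisimple.
Variables (k : closedFieldType) (G : finGroupType).
Hypothesis chark0 : [pchar k] =i pred0.

Lemma pchar0_group (gT : finGroupType) (H : {group gT}) : [pchar k]^'.-group H.
Proof. by apply/pgroupP => p _ _; rewrite inE /= chark0. Qed.

Lemma natr_inj_pchar0 : injective (fun n : nat => n%:R : k).
Proof.
have W m n : (m <= n)%N -> m%:R = n%:R :> k -> m = n.
  move=> le_mn /esym/eqP; rewrite -subr_eq0 -natrB // ((pcharf0P k).1 chark0).
  by rewrite subn_eq0 => le_nm; apply/eqP; rewrite eqn_leq le_mn.
move=> m n e; case/orP: (leq_total m n) => le; first exact: W.
by apply/esym/W.
Qed.

Let sG : irrType k [set: G]%G := DecSocleType (regular_repr k [set: G]%G).
Let pG : [pchar k]^'.-group [set: G]%G := pchar0_group _.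

(** The regular representation is faithful on the group algebra, and it splits
    into Wedderburn blocks, on each of which some irreducible representation
    is injective. *)
Lemma repr_ext_faithful (x : galg k G) :
  (forall n (rG : reprT k G n), mx_irreducible rG -> repr_ext rG x = 0) -> x = 0.
Proof.
move=> x0; pose A := repr_ext (regular_repr k [set: G]%G) x.
have RA : (A \in group_ring k [set: G]%G)%MS.
  by apply/envelop_mxP; exists (gcoef x); apply: eq_bigl => g; rewrite inE.
have A0 : A = 0.
  rewrite -[A]mulmx1 -(Wedderburn_sum_id_pchar sG pG) mulmx_sumr big1 // => i _.
  have irri := socle_irr i; have Ki := irr_reprK_pchar pG i.
  have R0 : (A *m Wedderburn_id i \in Wedderburn_subring i)%MS.
    case/andP: (Wedderburn_ideal i) => H _; apply: submx_trans H.
    by apply: mem_mulsmx => //; apply: Wedderburn_id_mem.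
  have := @regular_op_inj_pchar _ _ _ sG pG _ _ irri (A *m Wedderburn_id i) 0.
  rewrite !inE Ki; apply=> //; first by rewrite linear0 sub0mx.
  rewrite gring_opM; last first.
    by rewrite -(Wedderburn_sum_pchar sG pG) (sumsmx_sup i) ?Wedderburn_id_mem.
  by rewrite [gring_op _ A]gring_op_repr_ext x0 // mul0mx linear0.
apply/galgP => g; rewrite galg_0E.
have := congr1 (gring_proj g) A0; rewrite [RHS]linear0 /A /repr_ext.
rewrite [LHS]linear_sum (bigD1 g) //= big1 => [|h hg].
  rewrite linearZ /= gring_projE ?inE // eqxx addr0 => /matrixP/(_ 0 0).
  by rewrite !mxE mulr1.
by rewrite linearZ /= gring_projE ?inE // eq_sym (negbTE hg) scaler0.
Qed.

(** The idempotent is the identity of the Wedderburn block of [r0]. It tells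
    the irreducible representations apart without naming the block that they
    belong to. *)
Lemma irr_idempotent n0 (r0 : reprT k G n0) : mx_irreducible r0 ->
  exists e : galg k G, [/\ e * e = e, forall x, e * x = x * e
    & forall n (rG : reprT k G n), mx_irreducible rG ->
    (mx_rsim r0 rG -> repr_ext rG e = 1%:M) /\
    (~ mx_rsim r0 rG -> repr_ext rG e = 0)].
Proof.
move=> irr0; pose i := irr_comp sG r0.
have [e eE] : exists e, repr_ext (regular_repr k [set: G]%G) e = Wedderburn_id i.
  apply: repr_ext_onto.
  by rewrite -(Wedderburn_sum_pchar sG pG) (sumsmx_sup i) ?Wedderburn_id_mem.
have he n (rG : reprT k G n) : mx_irreducible rG ->
    (mx_rsim r0 rG -> repr_ext rG e = 1%:M) /\
    (~ mx_rsim r0 rG -> repr_ext rG e = 0).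
  move=> irrG; rewrite -gring_op_repr_ext eE; split=> [sim | nsim].
    rewrite /i (irr_comp_rsim_pchar sG pG sim).
    rewrite -(gring_op1 rG) -(Wedderburn_sum_id_pchar sG pG) linear_sum.
    rewrite (bigD1 (irr_comp sG rG)) //= addrC big1 ?add0r // => j ne_j.
    exact: (irr_comp'_op0_pchar pG irrG ne_j (Wedderburn_id_mem j)).
  apply: (irr_comp'_op0_pchar pG irrG _ (Wedderburn_id_mem i)).
  apply/eqP => ie; apply: nsim.
  apply: mx_rsim_trans (rsim_irr_comp_pchar sG pG irr0) _.
  by rewrite -/i ie; apply: mx_rsim_sym; apply: rsim_irr_comp_pchar.
suffices eq_irr x y : (forall n (rG : reprT k G n), mx_irreducible rG ->
    repr_ext rG x = repr_ext rG y) -> x = y.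
  exists e; split=> // [|x]; apply: eq_irr => n rG irrG; rewrite !repr_extM.
    have [sim|nsim] := pselect (mx_rsim r0 rG).
      by rewrite (he n rG irrG).1 // mulmx1.
    by rewrite (he n rG irrG).2 // mulmx0.
  have [sim|nsim] := pselect (mx_rsim r0 rG).
    by rewrite (he n rG irrG).1 // mulmx1 mul1mx.
  by rewrite (he n rG irrG).2 // mulmx0 mul0mx.
move=> eq_xy; apply/eqP; rewrite -subr_eq0; apply/eqP.
apply: repr_ext_faithful => n rG irrG.
by rewrite linearB /= eq_xy ?subrr.
Qed.

(** Over an algebraically closed field, each [r i] alone is onto the full
    matrix algebra (Burnside); multiplying by the block idempotents makes the
    values at different indices independent. *)
Lemma repr_ext_density (I : finType) (n : I -> nat) 
    (r : forall i, reprT k G (n i)) :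
  (forall i, mx_irreducible (r i)) -> (forall i j, mx_rsim (r i) (r j) -> i = j) ->
  forall X : (forall i, 'M[k]_(n i)), exists x, forall i, repr_ext (r i) x = X i.
Proof.
move=> irr_r nsim X.
have [e he] : exists e : I -> galg k G, forall i,
    repr_ext (r i) (e i) = 1%:M /\ forall j, j != i -> repr_ext (r j) (e i) = 0.
  apply: (fin_all_exists (P := fun i e => repr_ext (r i) e = 1%:M /\
    forall j, j != i -> repr_ext (r j) e = 0)) => i.
  have [e [_ _ he]] := irr_idempotent (irr_r i); exists e; split=> [|j ne_ji].
    by apply: (he _ _ (irr_r i)).1; apply: mx_rsim_refl.
  apply: (he _ _ (irr_r j)).2 => /nsim e_ij.
  by rewrite e_ij eqxx in ne_ji.
have [x hx] : exists x : I -> galg k G, forall i, repr_ext (r i) (x i) = X i.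
  apply: (fin_all_exists (P := fun i x => repr_ext (r i) x = X i)) => i.
  apply: repr_ext_onto; apply: submx_full.
  by case/andP: (group_closure_closed_field (irr_r i)).
exists (\sum_i x i * e i) => i; rewrite linear_sum (bigD1 i) //=.
rewrite big1 ?addr0 => [|j ne_ji].
  by rewrite repr_extM (he i).1 mulmx1.
by rewrite repr_extM (he j).2 ?mulmx0 // eq_sym.
Qed.

(** In characteristic zero a representation is determined by its character.
    By induction on the degree: let [U] be a simple submodule of [r1] and [e]
    its block idempotent. The trace of [e] in [r1] is the positive integer
    [\rank (repr_ext r1 e)]; it is also the trace of [e] in [r2], so [e] is
    nonzero there too, and any simple submodule [V] of its image in [r2] is
    isomorphic to [U]. Complements of [U] and [V] have equal characters. *)
Lemma mx_rsim_mxtrace n1 (r1 : reprT k G n1) n2 (r2 : reprT k G n2) :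
  (forall g, \tr (r1 g) = \tr (r2 g)) -> mx_rsim r1 r2.
Proof.
have [m] := ubnP n1; elim: m => // m IHm in n1 r1 n2 r2 *.
rewrite ltnS => le_n1 tr12.
have n12 : n1 = n2.
  apply: natr_inj_pchar0; have := tr12 1%g.
  by rewrite !repr_mx1 !mxtrace1.
(* In degree 0 the zero matrix is row free. *)
have [n10 | n1_gt0] := posnP n1.
  exists 0 => // [|g _]; first by rewrite /row_free mxrank0 n10.
  by rewrite mulmx0 mul0mx.
have mod1 n (r : reprT k G n) : mxmodule r 1%:M by apply: mxmodule1.
have [|U simU _] := dec_mxsimple_exists (mod1 _ r1).
  by rewrite -mxrank_eq0 mxrank1 -lt0n.
have modU := mxsimple_module simU; have [_ nzU _] := simU.
have irrU := (submod_mx_irr modU).2 simU.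
have [e [ee ce he]] := irr_idempotent irrU.
have idem_e n (r : reprT k G n) : repr_ext r e *m repr_ext r e = repr_ext r e.
  by rewrite -repr_extM ee.
have nz_val n (W : 'M[k]_n) : W != 0 -> val_submod (1%:M : 'M_(\rank W)) != 0.
  by rewrite -!mxrank_eq0 val_submod1.
have nze1 : repr_ext r1 e != 0.
  apply: contraNneq (nz_val _ _ nzU) => e0.
  have := val_submod_repr_ext modU 1%:M e; rewrite e0 mulmx0.
  rewrite (he _ _ irrU).1 ?mulmx1 => [->//|].
  exact: mx_rsim_refl.
have nze2 : repr_ext r2 e != 0.
  have : \tr (repr_ext r2 e) != 0.
    rewrite -lin_ext_trace -(eq_lin_ext tr12) lin_ext_trace idempotent_mxtrace //.
    by rewrite ((pcharf0P k).1 chark0) mxrank_eq0.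
  by apply: contraNneq => ->; rewrite mxtrace0.
have mode : mxmodule r2 (repr_ext r2 e).
  apply/mxmoduleP => g _.
  by rewrite -repr_ext_gelt -repr_extM ce repr_extM submxMl.
have [V simV sVe] := dec_mxsimple_exists mode nze2.
have modV := mxsimple_module simV; have [_ nzV _] := simV.
have irrV := (submod_mx_irr modV).2 simV.
(* Otherwise [e] would kill [V], while it fixes every row of its own image. *)
have simUV : mx_rsim (submod_repr modU) (submod_repr modV).
  apply: contrapT => nsim; have := nz_val _ _ nzV.
  have := val_submod_repr_ext modV 1%:M e.
  rewrite (he _ _ irrV).2 // mulmx0 linear0.
  have /submxP[D ->] : (val_submod (1%:M : 'M_(\rank V)) <= repr_ext r2 e)%MS.
    by rewrite val_submod1.
  by rewrite -mulmxA idem_e => <-; rewrite eqxx.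
have redG n (r : reprT k G n) := mx_Maschke_pchar r pG.
have [U' modU' defU dxU] := redG _ _ _ modU (submx1 _).
have [V' modV' defV dxV] := redG _ _ _ modV (submx1 _).
have simU'V' : mx_rsim (submod_repr modU') (submod_repr modV').
  apply: IHm => [|g].
    apply: leq_trans le_n1; rewrite -[X in (_ < X)%N](mxrank1 k) -defU.
    rewrite (mxdirectP dxU) /= -{1}[\rank U']add0n ltn_add2r lt0n mxrank_eq0 //.
  apply: (addrI (\tr (submod_repr modU g))).
  rewrite {2}(mxtrace_rsim simUV) ?inE //.
  rewrite (mxtrace_dadd_mod modU modU' (mod1 _ r1) defU dxU) ?inE //.
  rewrite (mxtrace_dadd_mod modV modV' (mod1 _ r2) defV dxV) ?inE //.
  by rewrite !mxtrace_submod1 ?inE.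
pose rU := Representation (submod_repr modU).
pose rU' := Representation (submod_repr modU').
apply: mx_rsim_trans (mx_rsim_sym (rsim_submod1 (mod1 _ r1) (eqmx_refl _))) _.
apply: mx_rsim_trans (rsim_submod1 (mod1 _ r2) (eqmx_refl _)).
apply: (@mx_rsim_trans _ _ _ _ _ _ _ (dadd_grepr rU rU')).
  by apply: mx_rsim_dadd defU dxU _ _; apply: mx_rsim_refl.
apply: mx_rsim_sym; apply: mx_rsim_dadd defV dxV _ _; exact: mx_rsim_sym.
Qed.

(** This is the statement that irreducible characters span the class functions,
    in a form that needs no basis. The average [z] of the conjugates of [a] is
    central, hence acts on each irreducible representation as a scalar, and a
    scalar of trace zero vanishes; so [z = 0] by faithfulness, while a class
    function takes on [z] the value [#|G|] times its value on [a]. *)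
Lemma lin_ext_class_eq0 (a : galg k G) :
  (forall n (rG : reprT k G n), mx_irreducible rG -> \tr (repr_ext rG a) = 0) ->
  forall phi, class_function phi -> lin_ext phi a = 0.
Proof.
move=> a0 phi cphi; pose z := \sum_h gelt k h * a * gelt k h^-1.
have tr_z psi : class_function psi -> lin_ext psi z = #|G|%:R * lin_ext psi a.
  move=> cpsi; rewrite linear_sum (eq_bigr (fun=> lin_ext psi a)) /= => [|h _].
    by rewrite sumr_const mulr_natl.
  by rewrite lin_extC // mulrA -geltM mulVg gelt1 mul1r.
have nz m : (0 < m)%N -> m%:R != 0 :> k.
  by rewrite ((pcharf0P k).1 chark0) -lt0n.
have nzG : #|G|%:R != 0 :> k by apply: nz; apply/card_gt0P; exists 1%g.
suffices z0 : z = 0.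
  apply/(mulfI nzG); rewrite -tr_z // z0 linear0 mulr0 //.
apply: repr_ext_faithful => n rG irrG.
have /is_scalar_mxP[c zc] : is_scalar_mx (repr_ext rG z).
  apply: (mx_abs_irr_cent_scalar (group_closure_closed_field irrG)).
  apply/centgmxP => g _; rewrite -repr_ext_gelt -!repr_extM; congr repr_ext.
  rewrite /z mulr_suml mulr_sumr (reindex_inj (mulgI g)) /=.
  by apply: eq_bigr => h _; rewrite invMg !geltM -!mulrA -geltM mulVg gelt1 mulr1.
have : \tr (repr_ext rG z) = 0.
  rewrite -lin_ext_trace tr_z ?lin_ext_trace ?a0 ?mulr0 // => g h.
  by rewrite !repr_mxM ?inE // mxtrace_mulC.
rewrite zc mxtrace_scalar => /eqP; rewrite -mulr_natl mulf_eq0.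
case/mx_irrP: irrG => n0 _; rewrite (negbTE (nz _ n0)) => /eqP ->.
by rewrite raddf0.
Qed.

End SplitSemisimple.

(** * Class functions *)

Section ClassFunctions.
Variables (k : fieldType) (G : finGroupType).
Implicit Types (g h u v : G) (phi : G -> k).

Definition class_ind h u : k := (u \in h ^: [set: G])%:R.

Lemma class_ind_class h : class_function (class_ind h).
Proof.
move=> u v; rewrite /class_ind; congr (nat_of_bool _)%:R.
apply: class_transl; apply/imsetP; exists v; rewrite ?inE //.
by rewrite conjgE !mulgA mulVg mul1g.
Qed.

Lemma class_function_conj phi : class_function phi ->
  forall h u, u \in h ^: [set: G] -> phi u = phi h.
Proof.
by move=> cphi h u /imsetP[v _ ->]; rewrite conjgE cphi -mulgA mulgV mulg1.
Qed.

Lemma irr_class_function chi : Irr k G chi -> class_function chi.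
Proof.
by case=> n [rG [_ chiE]] g h; rewrite !chiE !repr_mxM ?inE // mxtrace_mulC.
Qed.

Lemma lin_extZ c phi x : lin_ext (fun g => c * phi g) x = c * lin_ext phi x.
Proof. by rewrite /lin_ext mulr_sumr; apply: eq_bigr => g _; rewrite mulrCA. Qed.

(** The constant function 1 is the sum of the indicators of the conjugacy
    classes. *)
Lemma lin_ext_ind_eq0 x :
  (forall h, lin_ext (class_ind h) x = 0) -> lin_ext (fun=> 1) x = 0.
Proof.
move=> x0; pose one u : k := \sum_(C in classes [set: G]) (u \in C)%:R.
rewrite (@eq_lin_ext _ _ _ one) => [|u]; last first.
  rewrite /one (bigD1 (u ^: [set: G])) ?mem_classes ?inE //= class_refl.
  rewrite big1 ?addr0 // => C /andP[/imsetP[v _ ->] ne_uv].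
  by case: (u \in _) / class_eqP ne_uv => // ->; rewrite eqxx.
rewrite /lin_ext; under eq_bigr do rewrite mulr_sumr.
rewrite exchange_big big1 // => C /imsetP[h _ ->]; exact: x0.
Qed.
End ClassFunctions.

Lemma clP (G : finGroupType) (C : {set G}) :
  cl G C -> exists g, g \in C /\ C = g ^: [set: G].
Proof. by case/imsetP=> g _ ->; exists g; rewrite class_refl. Qed.

Lemma lin_ext_functional (k : fieldType) (G : finGroupType) (L : galg k G -> k) :
  linear_for *%R L -> forall x, L x = lin_ext (fun g => L (gelt k g)) x.
Proof.
move=> linL x.
pose L' : {linear galg k G -> k^o} :=
  HB.pack L (GRing.isLinear.Build k (galg k G) k^o *:%R L linL).
rewrite -[LHS]/(L' x) {1}[x]galg_decomp linear_sum.
by apply: eq_bigr => g _; rewrite linearZ.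
Qed.

Lemma trace_functional_eq (k : fieldType) (G : finGroupType) (a b : galg k G) :
  trace_equiv a b ->
  forall L : galg k G -> k,
    linear_for *%R L -> (forall x y, L (x * y) = L (y * x)) -> L a = L b.
Proof.
move=> eq_ab L linL LC; rewrite !(lin_ext_functional linL) eq_ab // => g h.
by rewrite !geltM LC.
Qed.

(** * Tensor squares and the coproduct *)

Section Comultiplication.
Variables (k : fieldType) (G : finGroupType).

Lemma comul_linear : linear (@comul k G).
Proof.
move=> a x y; rewrite /comul scaler_sumr -big_split /=; apply: eq_bigr => g _.
by rewrite galgDE galgZE scalerDl scalerA.
Qed.
HB.instance Definition _ :=
  GRing.isLinear.Build k (galg k G) (galg k (G * G)%type) _ (@comul k G) comul_linear.

Lemma comul1 : comul (1 : galg k G) = 1.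
Proof. by rewrite -gelt1 comul_gelt gelt1 tens1. Qed.

Lemma comulM (x y : galg k G) : comul (x * y) = comul x * comul y.
Proof.
rewrite [x]galg_decomp mulr_suml !(linear_sum (@comul k G)) mulr_suml /=.
apply: eq_bigr => g _; rewrite -scalerAl !linearZ -scalerAl; congr (_ *: _).
rewrite [y]galg_decomp mulr_sumr !(linear_sum (@comul k G)) mulr_sumr /=.
apply: eq_bigr => h _; rewrite -scalerAr !linearZ -scalerAr; congr (_ *: _).
by rewrite /= -geltM !comul_gelt tensM geltM.
Qed.

Lemma lin_ext_comul (theta : G * G -> k) x :
  lin_ext theta (comul x) = lin_ext (fun g => theta (g, g)) x.
Proof.
rewrite linear_sum; apply: eq_bigr => g _.
by rewrite linearZ /= tens_gelt lin_ext_gelt.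
Qed.

Lemma lin_ext_tens (phi psi : G -> k) (x y : galg k G) :
  lin_ext (fun p => phi p.1 * psi p.2) (tens x y) = lin_ext phi x * lin_ext psi y.
Proof.
rewrite /lin_ext big_distrlr pair_big /=; apply: eq_bigr => p _.
by rewrite tensE mulrACA.
Qed.
End Comultiplication.

Lemma tens_map_linear (k : fieldType) (G1 H1 G2 H2 : finGroupType)
    (f : {linear galg k G1 -> galg k G2}) (f' : {linear galg k H1 -> galg k H2}) :
  linear (tens_map f f').
Proof.
move=> a x y; rewrite /tens_map scaler_sumr -big_split /=; apply: eq_bigr => p _.
by rewrite galgDE galgZE scalerDl scalerA.
Qed.
HB.instance Definition _ (k : fieldType) (G1 H1 G2 H2 : finGroupType)
    (f : {linear galg k G1 -> galg k G2}) (f' : {linear galg k H1 -> galg k H2}) :=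
  GRing.isLinear.Build k (galg k (G1 * H1)%type) (galg k (G2 * H2)%type) _
    (@tens_map k G1 H1 G2 H2 f f') (tens_map_linear f f').

(** Both sides are linear in [x], and the coproduct of a group element is its
    tensor square. *)
Lemma twist_on_group (k : fieldType) (G1 G2 : finGroupType)
    (f : {linear galg k G1 -> galg k G2}) (F : galg k (G2 * G2)%type) :
  (forall g, F * comul (f (gelt k g)) = tens (f (gelt k g)) (f (gelt k g)) * F) ->
  forall x, F * comul (f x) = tens_map f f (comul x) * F.
Proof.
move=> Fg x; rewrite [x]galg_decomp (linear_sum f) !(linear_sum (@comul k _)).
rewrite (linear_sum (tens_map f f)) mulr_sumr mulr_suml.
apply: eq_bigr => g _; rewrite !linearZ /= -scalerAr Fg -scalerAl.
by rewrite comul_gelt tens_map_tens.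
Qed.

(** A class function of G x G is a trace functional in each tensor factor when
    the other factor is held fixed, so the factors can be replaced one at a
    time. *)
Lemma trace_equiv_tens_square (k : fieldType) (G : finGroupType)
    (a b : galg k G) :
  trace_equiv a b -> trace_equiv (tens a a) (tens b b).
Proof.
move=> eq_ab theta ctheta; transitivity (lin_ext theta (tens b a)).
  apply: (trace_functional_eq eq_ab
    (L := fun x => lin_ext theta (tens x a))) => [c x y|x y].
    by rewrite tens_linearl linearP.
  by rewrite -[in LHS](mul1r a) -tensM lin_extC // tensM mulr1.
apply: (trace_functional_eq eq_ab
  (L := fun y => lin_ext theta (tens b y))) => [c x y|x y].
  by rewrite tens_linearr linearP.
by rewrite -[in LHS](mul1r b) -tensM lin_extC // tensM mulr1.
Qed.

(** * Conjugacy of homomorphisms into a group algebra *)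

Section Bimodule.
Variables (k : fieldType) (G H : finGroupType).

Definition galg_row (b : galg k H) : 'rV[k]_#|H| := \row_i gcoef b (enum_val i).
Definition row_galg (v : 'rV[k]_#|H|) : galg k H :=
  galg_of (fun h => v 0 (enum_rank h)).

Lemma galg_rowK : cancel galg_row row_galg.
Proof. by move=> b; apply/galgP => h; rewrite galg_ofE mxE enum_rankK. Qed.
Lemma row_galgK : cancel row_galg galg_row.
Proof. by move=> v; apply/rowP => i; rewrite mxE galg_ofE enum_valK. Qed.

(** A multiplicative [alpha : G -> k[H]] and right translations make k[H] a
    representation of G x H, where (g, h) maps b to alpha(g)^-1 b h. The
    inverse makes it a right action, as matrices act on row vectors here. *)
Definition bimod_mx (alpha : G -> galg k H) (p : G * H) : 'M[k]_#|H| :=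
  \matrix_(i, j)
    gcoef (alpha p.1^-1%g * gelt k (enum_val i * p.2)%g) (enum_val j).

Lemma galg_row_bimod_mx alpha b p :
  galg_row b *m bimod_mx alpha p = galg_row (alpha p.1^-1%g * b * gelt k p.2).
Proof.
apply/rowP => j; rewrite !mxE -mulrA [b in RHS]galg_decomp mulr_suml mulr_sumr.
rewrite galg_sumE (reindex _ (onW_bij _ (enum_val_bij H))) /=.
apply: eq_bigr => i _; rewrite !mxE -scalerAl -scalerAr galgZE.
by rewrite geltM.
Qed.

Variable alpha : G -> galg k H.
Hypothesis alpha1 : alpha 1%g = 1.
Hypothesis alphaM : forall g h, alpha (g * h)%g = alpha g * alpha h.

Lemma bimod_mx_repr : mx_repr [set: G * H]%G (bimod_mx alpha).
Proof.
split=> [|p q _ _]; apply/row_matrixP => i; rewrite !rowE -[delta_mx _ _]row_galgK.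
  by rewrite galg_row_bimod_mx invg1 alpha1 mul1r gelt1 mulr1 row_galgK mulmx1.
by rewrite mulmxA !galg_row_bimod_mx /= invMg alphaM geltM !mulrA.
Qed.
Definition bimod_repr : mx_representation k [set: G * H]%G #|H| :=
  MxRepresentation bimod_mx_repr.
End Bimodule.

(** The number of fixed points of the permutation [u |-> v u h] of [H], that is
    the trace of this map on k[H]. *)
Definition trace_weight (k : fieldType) (H : finGroupType) (h v : H) : k :=
  \sum_u (u == v * (u * h))%g%:R.

Lemma trace_weight_class k (H : finGroupType) h :
  class_function (@trace_weight k H h).
Proof.
move=> v w; rewrite /trace_weight (reindex_inj (mulgI v)) /=.
by apply: eq_bigr => u _; rewrite -!mulgA (inj_eq (mulgI v)) !mulgA.
Qed.

Lemma mxtrace_bimod (k : fieldType) (G H : finGroupType)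
    (alpha : G -> galg k H) p :
  \tr (bimod_mx alpha p) = lin_ext (trace_weight k p.2) (alpha p.1^-1%g).
Proof.
rewrite /mxtrace /lin_ext.
transitivity (\sum_u gcoef (alpha p.1^-1%g * gelt k (u * p.2)%g) u).
  rewrite [RHS](reindex _ (onW_bij _ (enum_val_bij H))) /=.
  by apply: eq_bigr => i _; rewrite mxE.
under [RHS]eq_bigr do rewrite mulr_sumr.
rewrite [RHS]exchange_big /=; apply: eq_bigr => u _.
rewrite [alpha _]galg_decomp mulr_suml galg_sumE; apply: eq_bigr => g _.
by rewrite -scalerAl galgZE -geltM geltE -galg_decomp.
Qed.

(** The intertwiner [Psi] of the two bimodules commutes with right
    translations, so it is left multiplication by [Psi 1]; being bijective, it
    makes [Psi 1] a unit, and compatibility with the left actions is the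
    conjugation relation. *)
Lemma conjugating_unit (k : closedFieldType) (chark0 : [pchar k] =i pred0)
    (G H : finGroupType) (alpha beta : G -> galg k H) :
  alpha 1%g = 1 -> (forall g h, alpha (g * h)%g = alpha g * alpha h) ->
  beta 1%g = 1 -> (forall g h, beta (g * h)%g = beta g * beta h) ->
  (forall g, trace_equiv (alpha g) (beta g)) ->
  exists2 F : galg k H,
    F \is a GRing.unit & forall g, F * beta g = alpha g * F.
Proof.
move=> a1 aM b1 bM eq_ab.
have [|X _ freeX homX] :=
    @mx_rsim_mxtrace _ _ chark0 _ (bimod_repr b1 bM) _ (bimod_repr a1 aM).
  by move=> p; rewrite /= !mxtrace_bimod eq_ab //; apply: trace_weight_class.
pose Psi b := row_galg (galg_row b *m X).
have PsiE g h b : Psi (beta g * b * gelt k h) = alpha g * Psi b * gelt k h.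
  apply: (can_inj (@galg_rowK _ _)); rewrite row_galgK.
  rewrite -{1 2}(invgK g).
  rewrite -(galg_row_bimod_mx _ _ (g^-1%g, h)).
  rewrite -(galg_row_bimod_mx _ _ (g^-1%g, h)).
  by rewrite -mulmxA (homX (g^-1%g, h)) ?inE // row_galgK mulmxA.
have Psi_lin : linear Psi.
  move=> a x y; apply/galgP => h; rewrite galgDE galgZE !galg_ofE.
  rewrite !mxE mulr_sumr -big_split; apply: eq_bigr => i _ /=.
  by rewrite !mxE galgDE galgZE mulrDl mulrA.
pose L : {linear galg k H -> galg k H} :=
  HB.pack Psi (GRing.isLinear.Build k (galg k H) (galg k H) *:%R Psi Psi_lin).
have PsiM b : Psi b = Psi 1 * b.
  rewrite -[LHS]/(L b) {1 2}[b]galg_decomp linear_sum mulr_sumr /=.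
  apply: eq_bigr => h _; rewrite -[Psi _]/(L _) linearZ -scalerAr.
  congr (_ *: _).
  by have := PsiE 1%g h 1; rewrite a1 b1 !mul1r.
have uX : X \in unitmx by rewrite -row_free_unit.
pose V := row_galg (galg_row 1 *m invmx X).
have FV : Psi 1 * V = 1 by rewrite -PsiM /Psi row_galgK mulmxKV // galg_rowK.
have VF : V * Psi 1 = 1.
  have: Psi (V * Psi 1) = Psi 1 by rewrite PsiM mulrA FV mul1r.
  move/(can_inj (@row_galgK _ _))/(can_inj (mulmxK uX)).
  exact: (can_inj (@galg_rowK _ _)).
exists (Psi 1) => [|g]; first by apply/unitrP; exists V.
by rewrite -PsiM; have := PsiE g 1%g 1; rewrite gelt1 !mulr1.
Qed.

(** * From character tables to a twisted isomorphism *)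

Section AlgIso.
Variables (k : fieldType) (G1 G2 : finGroupType) (I : finType) (n : I -> nat).

Definition separating G (r : forall i, reprT k G (n i)) :=
  forall x y, (forall i, repr_ext (r i) x = repr_ext (r i) y) -> x = y.
Definition dense G (r : forall i, reprT k G (n i)) :=
  forall X : (forall i, 'M[k]_(n i)), exists x, forall i, repr_ext (r i) x = X i.

(** Both group algebras are identified with the product of the matrix algebras
    of sizes [n i]. *)
Lemma lrmorphism_of_blocks (r1 : forall i, reprT k G1 (n i))
    (r2 : forall i, reprT k G2 (n i)) :
  separating r1 -> dense r1 -> separating r2 -> dense r2 ->
  exists2 f : {lrmorphism galg k G1 -> galg k G2},
    bijective f & forall i x, repr_ext (r2 i) (f x) = repr_ext (r1 i) x.
Proof.
move=> sep1 dense1 sep2 dense2.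
have [f fE] := choice (fun x => dense2 (fun i => repr_ext (r1 i) x)).
have [g gE] := choice (fun y => dense1 (fun i => repr_ext (r2 i) y)).
have f_lin : linear f.
  by move=> a x y; apply: sep2 => i; rewrite fE !linearP /= !fE.
have f_mul : monoid_morphism f.
  split=> [|x y]; apply: sep2 => i; first by rewrite fE !repr_ext1.
  by rewrite repr_extM !fE repr_extM.
pose ml := GRing.isLinear.Build k (galg k G1) (galg k G2) *:%R f f_lin.
pose mm := GRing.isMonoidMorphism.Build (galg k G1) (galg k G2) f f_mul.
pose F : {lrmorphism galg k G1 -> galg k G2} := HB.pack f ml mm.
exists F => //; exists g => x; first by apply: sep1 => i; rewrite gE fE.
by apply: sep2 => i; rewrite fE gE.
Qed.
End AlgIso.

Lemma irr_family_separating (k : closedFieldType) (chark0 : [pchar k] =i pred0)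
    (G : finGroupType) (I : finType) (n : I -> nat)
    (r : forall i, reprT k G (n i)) :
  (forall m (rG : reprT k G m),
    mx_irreducible rG -> exists i, mx_rsim rG (r i)) ->
  separating r.
Proof.
move=> complete x y eq_xy; apply/eqP; rewrite -subr_eq0; apply/eqP.
apply: (repr_ext_faithful chark0) => m rG.
case/complete=> i /repr_ext_rsim[B [C [_ _ ->]]].
by rewrite linearB /= eq_xy subrr mulmx0 mul0mx.
Qed.

Lemma mxtrace_regular_neq0 (k : fieldType) (G : finGroupType) (c : G) :
  \tr (regular_repr k [set: G]%G c) != 0 -> c = 1%g.
Proof.
apply: contraNeq => nt_c; rewrite /mxtrace big1 // => i _.
rewrite 2!mxE /= -(inj_eq enum_val_inj) gring_indexK ?inE //.
by rewrite eq_mulVg1 mulKg (negbTE nt_c).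
Qed.

(** The regular character at [c] is the sum of the chi(c) chi(1), which is here
    a positive integer, whereas it vanishes off the identity. *)
Lemma natural_character_eq1 (k : closedFieldType) (chark0 : [pchar k] =i pred0)
    (G : finGroupType) (c : G) :
  (forall chi, Irr k G chi -> exists2 m, (0 < m)%N & chi c = m%:R) -> c = 1%g.
Proof.
move=> chi_c; apply: (@mxtrace_regular_neq0 k).
pose sG : irrType k [set: G]%G := DecSocleType (regular_repr k [set: G]%G).
rewrite (mxtrace_regular_pchar sG) ?inE //; first last.
- exact: group_closure_closed_field.
- exact: pchar0_group.
have /fin_all_exists[m mE] (i : sG) :
    exists m, (0 < m)%N /\ \tr (irr_repr i c) = m%:R.
  have [|m m0 mE] := chi_c [ffun g => \tr (irr_repr i g)].
    by exists _, (irr_repr i); split=> [|g]; [apply: socle_irr | rewrite ffunE].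
  by exists m; rewrite -mE ffunE.
rewrite (eq_bigr (fun i => (m i * irr_degree i)%:R)) => [|i _]; last first.
  by rewrite [\tr _](mE i).2 natrM mulr_natr.
rewrite -natr_sum ((pcharf0P k).1 chark0) -lt0n.
rewrite (bigD1 (principal_comp sG)) //= addn_gt0 muln_gt0 (mE _).1.
by rewrite irr_degree_gt0.
Qed.

Section FromTables.
Variables (k : closedFieldType) (G1 G2 : finGroupType).
Hypothesis chark0 : [pchar k] =i pred0.

(** The isomorphism matches the blocks of [r1], the irreducible representations
    of [G1], with those of [r2], which afford the matched characters of [G2].
    For [h] in the class matched with that of [g], the trace of [r2 i] at
    [f g] is that of [r1 i] at [g], hence that of [r2 i] at [h]. *)
Lemma lrmorphism_of_tables : same_character_tables k G1 G2 ->
  exists2 f : {lrmorphism galg k G1 -> galg k G2}, bijective f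
    & forall g, exists h, trace_equiv (f (gelt k g)) (gelt k h).
Proof.
case=> s [t [[s_fun s_inj s_surj] [t_fun _ _] st]].
pose sG : irrType k [set: G1]%G := DecSocleType (regular_repr k [set: G1]%G).
have pG : [pchar k]^'.-group [set: G1]%G by apply: pchar0_group.
pose r1 (i : sG) := irr_repr i; pose chi i := [ffun g => \tr (r1 i g)].
have irr1 i : mx_irreducible (r1 i) by apply: socle_irr.
have nsim1 i j : mx_rsim (r1 i) (r1 j) -> i = j.
  by move/(irr_comp_rsim_pchar sG pG); rewrite !irr_reprK_pchar.
have complete1 m (rG : reprT k G1 m) :
    mx_irreducible rG -> exists i, mx_rsim rG (r1 i).
  by move=> irrG; exists (irr_comp sG rG); apply: rsim_irr_comp_pchar.
have chi_irr i : Irr k G1 (chi i).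
  by exists _, (r1 i); split=> // g; rewrite ffunE.
have chiP x : Irr k G1 x -> exists i, x = chi i.
  case=> m [rG [/complete1[i sim] xE]]; exists i; apply/ffunP=> g.
  by rewrite xE ffunE (mxtrace_rsim sim) ?inE.
(* All matched characters have at [c] the degree of their partner. *)
have t1 : 1%g \in t 1%g.
  have cl1 : cl G1 1%g by apply: classes1.
  have [c [ct _]] := clP (t_fun _ cl1).
  suffices <- : c = 1%g by [].
  apply: (natural_character_eq1 chark0) => psi /s_surj[x irr_x <-].
  rewrite (st x _ irr_x cl1 1%g) ?set11 //; have [i ->] := chiP x irr_x.
  by exists (irr_degree i); rewrite ?irr_degree_gt0 // ffunE repr_mx1 mxtrace1.
have s1 i : s (chi i) 1%g = (irr_degree i)%:R.
  rewrite (st _ _ (chi_irr i) (classes1 _) 1%g) ?set11 //.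
  by rewrite ffunE repr_mx1 mxtrace1.
have /fin_all_exists[r2 r2P] (i : sG) : exists rG : reprT k G2 (irr_degree i),
    mx_irreducible rG /\ forall h, s (chi i) h = \tr (rG h).
  have [m [rG [irrG sE]]] := s_fun _ (chi_irr i).
  have /(natr_inj_pchar0 chark0) e : m%:R = (irr_degree i)%:R :> k.
    by rewrite -s1 sE repr_mx1 mxtrace1.
  by rewrite -e; exists rG.
have nsim2 i j : mx_rsim (r2 i) (r2 j) -> i = j.
  move=> sim; apply: nsim1; apply: (mx_rsim_mxtrace chark0) => g.
  have : chi i = chi j.
    apply: s_inj; rewrite ?inE //; apply/ffunP=> h.
    by rewrite !(r2P _).2 (mxtrace_rsim sim) ?inE.
  by move/ffunP/(_ g); rewrite !ffunE.
have complete2 m (rG : reprT k G2 m) :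
    mx_irreducible rG -> exists i, mx_rsim rG (r2 i).
  move=> irrG; have [|x irr_x sx] := s_surj [ffun h => \tr (rG h)].
    by exists m, rG; split=> // h; rewrite ffunE.
  have [i xi] := chiP _ irr_x; exists i; apply: (mx_rsim_mxtrace chark0) => h.
  by rewrite -(r2P i).2 -xi sx ffunE.
have [||||f bij_f fE] := @lrmorphism_of_blocks k G1 G2 _ _ r1 r2.
- exact: irr_family_separating.
- exact: repr_ext_density.
- exact: irr_family_separating.
- by apply: repr_ext_density => // i; apply: (r2P i).1.
exists f => // g; pose C := g ^: [set: G1].
have clC : cl G1 C by apply: mem_classes; rewrite inE.
have [h [hC _]] := clP (t_fun _ clC); exists h => phi cphi.
apply/eqP; rewrite -subr_eq0 -linearB; apply/eqP.
apply: (lin_ext_class_eq0 chark0) => // m rG /complete2[i sim].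
rewrite (mxtrace_repr_ext_rsim _ sim) !linearB /= fE !repr_ext_gelt -(r2P i).2.
by rewrite (st _ C (chi_irr i) clC g) ?class_refl // ffunE subrr.
Qed.

(** The two maps to be conjugated are [g |-> f(g) (x) f(g)] and
    [g |-> Delta2(f(g))]: if [h] corresponds to [g], both are trace equivalent
    to [h (x) h]. *)
Lemma qHopf_of_tables :
  same_character_tables k G1 G2 -> qHopf_isomorphic k G1 G2.
Proof.
case/lrmorphism_of_tables=> f bij_f fE.
pose alpha g := tens (f (gelt k g)) (f (gelt k g)).
pose beta g := comul (f (gelt k g)).
have [|||||F uF FE] := @conjugating_unit k chark0 G1 (G2 * G2)%type alpha beta.
- by rewrite /alpha gelt1 rmorph1 tens1.
- by move=> g h; rewrite /alpha tensM geltM rmorphM.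
- by rewrite /beta gelt1 rmorph1 comul1.
- by move=> g h; rewrite /beta geltM rmorphM comulM.
- move=> g theta ctheta; have [h hE] := fE g.
  have cl_diag : class_function (fun u => theta (u, u)).
    by move=> u v; apply: (ctheta (u, u) (v, v)).
  rewrite lin_ext_comul hE // lin_ext_gelt.
  by rewrite (trace_equiv_tens_square hE) // tens_gelt lin_ext_gelt.
exists f, F; split=> //; apply: twist_on_group => g; exact: FE.
Qed.

End FromTables.

(** * From a twisted isomorphism to character tables *)

Section Pullback.
Variables (k : fieldType) (G1 G2 : finGroupType).
Variable f : {lrmorphism galg k G1 -> galg k G2}.

Definition pullback (phi : G2 -> k) : {ffun G1 -> k} :=
  [ffun g => lin_ext phi (f (gelt k g))].

Lemma lin_ext_pullback phi x : lin_ext (pullback phi) x = lin_ext phi (f x).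
Proof.
rewrite [x in RHS]galg_decomp !linear_sum; apply: eq_bigr => g _.
by rewrite !linearZ /= ffunE.
Qed.

Lemma pullback_class phi : class_function phi -> class_function (pullback phi).
Proof. by move=> cphi g h; rewrite !ffunE !geltM !rmorphM lin_extC. Qed.

Lemma pullback_mx_repr n (rG : reprT k G2 n) :
  mx_repr [set: G1]%G (fun g => repr_ext rG (f (gelt k g))).
Proof.
split=> [|g h _ _]; first by rewrite gelt1 rmorph1 repr_ext1.
by rewrite geltM rmorphM repr_extM.
Qed.

Definition pullback_repr n (rG : reprT k G2 n) :=
  MxRepresentation (pullback_mx_repr rG).

Lemma repr_ext_pullback n (rG : reprT k G2 n) x :
  repr_ext (pullback_repr rG) x = repr_ext rG (f x).
Proof.
rewrite [x in RHS]galg_decomp !linear_sum; apply: eq_bigr => g _.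
by rewrite !linearZ.
Qed.

(** As [f] is onto, the matrices of the pulled back representation span the
    same algebra as those of the original one, so they stabilize the same
    subspaces. *)
Lemma pullback_irr : (forall y, exists x, f x = y) ->
  forall phi, Irr k G2 phi -> Irr k G1 (pullback phi).
Proof.
move=> f_onto phi [n [rG [irrG phiE]]].
exists n, (pullback_repr rG); split=> [|g]; last first.
  by rewrite ffunE (eq_lin_ext phiE) lin_ext_trace.
case/mx_irrP: irrG => n_gt0 simG; apply/mx_irrP; split=> // U modU; apply: simG.
apply/mxmoduleP=> h _; have [x fx] := f_onto (gelt k h).
rewrite -repr_ext_gelt -fx -repr_ext_pullback.
rewrite /repr_ext mulmx_sumr summx_sub // => g _.
by rewrite -scalemxAr scalemx_sub // (mxmoduleP modU) ?inE.
Qed.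
End Pullback.

Lemma lrmorphism_inverse (k : fieldType) (G1 G2 : finGroupType)
    (f : {lrmorphism galg k G1 -> galg k G2}) :
  bijective f ->
  exists f' : {lrmorphism galg k G2 -> galg k G1}, cancel f f' /\ cancel f' f.
Proof.
case=> g fK gK; have f_inj := can_inj fK.
have g_lin : linear g by move=> a x y; apply: f_inj; rewrite gK linearP /= !gK.
have g_mul : monoid_morphism g.
  split=> [|x y]; apply: f_inj; first by rewrite gK rmorph1.
  by rewrite gK rmorphM /= !gK.
pose ml := GRing.isLinear.Build k (galg k G2) (galg k G1) *:%R g g_lin.
pose mm := GRing.isMonoidMorphism.Build (galg k G2) (galg k G1) g g_mul.
pose f' : {lrmorphism galg k G2 -> galg k G1} := HB.pack g ml mm.
by exists f'.
Qed.

Section FromTwist.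
Variables (k : fieldType) (G1 G2 : finGroupType).
Variables (f : {lrmorphism galg k G1 -> galg k G2}).
Variables (f' : {lrmorphism galg k G2 -> galg k G1}) (F : galg k (G2 * G2)%type).
Hypotheses (fK : cancel f f') (f'K : cancel f' f).
Hypothesis uF : F \is a GRing.unit.
Hypothesis twistF : forall x, F * comul (f x) = tens_map f f (comul x) * F.

(** The twist enters here: a class function of [G2 * G2] does not see the
    conjugation by [F], which turns [comul (f g)] into the tensor square of
    [f g]. *)
Lemma pullback_mul phi psi : class_function phi -> class_function psi ->
  forall g, pullback f (fun h => phi h * psi h) g =
    pullback f phi g * pullback f psi g.
Proof.
move=> cphi cpsi g; rewrite !ffunE.
pose theta p := phi p.1 * psi p.2.
have ctheta : class_function theta by move=> p q; rewrite /theta cphi cpsi.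
rewrite -(lin_ext_comul theta) -lin_ext_tens -tens_map_tens -comul_gelt -/theta.
rewrite -[tens_map _ _ _](mulrK uF) -twistF.
by rewrite lin_extC // mulrA mulVr // mul1r.
Qed.

(** Evaluating pullbacks at [g] is a unital multiplicative functional on the
    class functions of [G2], so it has to be evaluation at some conjugacy
    class; the relation says that this class is the one of [h]. *)
Definition corresponds (g : G1) (h : G2) :=
  forall phi, class_function phi -> pullback f phi g = phi h.

Lemma pullbackK phi : pullback f (pullback f' phi) =1 phi.
Proof. by move=> g; rewrite ffunE lin_ext_pullback fK lin_ext_gelt. Qed.

Lemma pullbackVK phi : pullback f' (pullback f phi) =1 phi.
Proof. by move=> h; rewrite ffunE lin_ext_pullback f'K lin_ext_gelt. Qed.

(** A class function times the indicator of the class of [h] is a multiple of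
    this indicator, namely by its value at [h]. *)
Lemma corresponds_of_ind g h :
  pullback f (class_ind k h) g != 0 -> corresponds g h.
Proof.
move=> nz phi cphi; apply: (mulIf nz).
rewrite -pullback_mul //; last exact: class_ind_class.
rewrite !ffunE -lin_extZ; apply: eq_lin_ext => u; rewrite /class_ind.
case: (boolP (u \in _)) => [uh|_]; last by rewrite !mulr0.
by rewrite (class_function_conj cphi uh).
Qed.

Lemma corresponds_right g : exists h, corresponds g h.
Proof.
have cc : class_function (fun=> 1 : k) by [].
(* Multiplying a pullback by the pullback of 1 does not change it, and the
   constant 1 is itself a pullback. *)
have nz1 : pullback f (fun=> 1) g != 0.
  have : pullback f (fun h => 1 * pullback f' (fun=> 1) h) g = 1.
    rewrite -[RHS](pullbackK (fun=> 1) g) ffunE [RHS]ffunE.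
    by apply: eq_lin_ext => h; rewrite mul1r.
  rewrite (pullback_mul (cc G2) (pullback_class f' (cc G1))) pullbackK mulr1 => ->.
  exact: oner_neq0.
apply: contrapT => nocor; move: nz1; rewrite ffunE lin_ext_ind_eq0 ?eqxx // => h.
apply: contrapT => /eqP nz; apply: nocor; exists h.
by apply: corresponds_of_ind; rewrite ffunE.
Qed.

(** Otherwise the pullback of the indicator of the class of [h] would be zero,
    but pullback is injective. *)
Lemma corresponds_left h : exists g, corresponds g h.
Proof.
apply: contrapT => nocor; have := pullbackVK (class_ind k h) h.
rewrite [RHS]/class_ind class_refl ffunE /lin_ext big1 => [/esym/eqP|g _].
  by rewrite oner_eq0.
have [->|nz] := eqVneq (pullback f (class_ind k h) g) 0; first by rewrite mulr0.
by case: nocor; exists g; apply: corresponds_of_ind.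
Qed.

(** Corresponding elements take the same values under all pairs of matched
    class functions, and indicators separate conjugacy classes on either
    side. *)
Lemma corresponds_conj g h g' h' : corresponds g h -> corresponds g' h' ->
  (g' \in g ^: [set: G1]) = (h' \in h ^: [set: G2]).
Proof.
move=> gh g'h'; apply/idP/idP => [gg' | hh'].
  have := g'h' _ (@class_ind_class k _ h).
  rewrite (class_function_conj (pullback_class f (@class_ind_class k _ h)) gg').
  rewrite (gh _ (@class_ind_class _ _ h)) /class_ind class_refl.
  by case: (h' \in _) => // /eqP; rewrite oner_eq0.
have cphi := pullback_class f' (@class_ind_class k _ g).
have := class_function_conj cphi hh'.
rewrite -(gh _ cphi) -(g'h' _ cphi) !pullbackK /class_ind class_refl.
by case: (g' \in _) => // /esym/eqP; rewrite oner_eq0.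
Qed.

Lemma corresponds_class g h u :
  corresponds g h -> u \in h ^: [set: G2] -> corresponds g u.
Proof.
by move=> gh uh phi cphi; rewrite gh // (class_function_conj cphi uh).
Qed.

Lemma tables_of_twist : same_character_tables k G1 G2.
Proof.
pose t (C : {set G1}) :=
  [set h : G2 | `[< exists2 g, g \in C & corresponds g h >]]%SET.
have tE g h : corresponds g h -> t (g ^: [set: G1]) = h ^: [set: G2].
  move=> gh; apply/setP=> u.
  rewrite inE; apply/asboolP/idP => [[g' gg' g'u] | hu].
    by rewrite -(corresponds_conj gh g'u).
  by exists g; [apply: class_refl | apply: corresponds_class gh hu].
have f_onto y : exists x, f x = y by exists (f' y).
have f'_onto x : exists y, f' y = x by exists (f x).
exists (fun chi => pullback f' chi), t; split.
- split=> [chi|chi chi' _ _ eq_chi|psi irr_psi].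
  + exact: pullback_irr.
  + by apply/ffunP=> g; rewrite -(pullbackK chi) eq_chi pullbackK.
  + exists (pullback f psi); first exact: pullback_irr.
    by apply/ffunP=> h; rewrite pullbackVK.
- split=> [C /imsetP[g _ ->]|C C'|D /imsetP[h _ ->]].
  + have [h gh] := corresponds_right g.
    by rewrite /cl /= (tE _ _ gh) mem_classes ?inE.
  + rewrite !inE => /imsetP[g _ ->] /imsetP[g' _ ->].
    have [h gh] := corresponds_right g; have [h' g'h'] := corresponds_right g'.
    rewrite (tE _ _ gh) (tE _ _ g'h') => /esym/class_eqP hh'.
    by apply/esym/class_eqP; rewrite (corresponds_conj gh g'h').
  + have [g gh] := corresponds_left h; exists (g ^: [set: G1]); last exact: tE.
    by apply: mem_classes; rewrite inE.
move=> chi C irr_chi /imsetP[g0 _ ->] g h gC.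
rewrite inE => /asboolP[g' g'C gh]; have cchi := irr_class_function irr_chi.
rewrite -(gh _ (pullback_class f' cchi)) pullbackK.
by rewrite (class_function_conj cchi gC) (class_function_conj cchi g'C).
Qed.
End FromTwist.

Theorem corollary1 (k : closedFieldType) (chark0 : [pchar k]%R =i pred0)
    (G1 G2 : finGroupType) :
  same_character_tables k G1 G2 <-> qHopf_isomorphic k G1 G2.
Proof.
split=> [|[f [F [bij_f uF twistF]]]]; first exact: qHopf_of_tables.
have [f' [fK f'K]] := lrmorphism_inverse bij_f.
exact: tables_of_twist fK f'K uF twistF.
Qed.
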